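(* Let $W\in\mathbb{R}^{n\times n}$ be symmetric positive definite and let $T\in\mathbb{R}^{n\times n}$ be symmetric, indefinite and nonsingular. Let $\lambda_{\max}$ be the largest eigenvalue of $W$ and let $\mu_{\min}>0$ be the smallest absolute value of an eigenvalue of $T$. For $\alpha>0$ put $$\sigma(\alpha)=\frac{\lambda_{\max}}{\alpha+\lambda_{\max}}\cdot\frac{\sqrt{\alpha^{2}+\mu_{\min}^{2}}}{\mu_{\min}}.$$ Then $\alpha^{*}=\mu_{\min}^{2}/\lambda_{\max}$ minimizes $\sigma$ over $(0,\infty)$, and $$\min_{\alpha>0}\sigma(\alpha)=\sigma(\alpha^{*})=\frac{\lambda_{\max}}{\sqrt{\lambda_{\max}^{2}+\mu_{\min}^{2}}}.$$
   Context: A real symmetric matrix is indefinite if it has at least one positive and at least one negative eigenvalue. (The function $\sigma(\alpha)$ is the upper bound used for the spectral radius of the iteration matrix $\mathrm{i}T^{-1}W(\alpha I+W)^{-1}(\alpha I-\mathrm{i}T)$ of the LHSS iteration for $(W+\mathrm{i}T)x=b$.) *)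

(* Defs.v *)
From HB Require Import structures.
From mathcomp Require Import all_boot all_order all_algebra.
From mathcomp Require Import reals.

Set Implicit Arguments.
Unset Strict Implicit.
Unset Printing Implicit Defensive.

Import Order.TTheory GRing.Theory Num.Theory.
Local Open Scope ring_scope.

Definition spd (R : realType) (n : nat) (A : 'M[R]_n) : Prop :=
  A \is symmetricmx /\
  forall x : 'cV[R]_n, x != 0 -> 0 < (x^T *m A *m x) 0 0.

Definition indefinite (R : realType) (n : nat) (A : 'M[R]_n) : Prop :=
  (exists2 a : R, eigenvalue A a & 0 < a) /\
  (exists2 b : R, eigenvalue A b & b < 0).

Definition largest_eigenvalue (R : realType) (n : nat) (A : 'M[R]_n)
    (lam : R) : Prop :=
  eigenvalue A lam /\ forall a : R, eigenvalue A a -> a <= lam.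

Definition smallest_abs_eigenvalue (R : realType) (n : nat) (A : 'M[R]_n)
    (mu : R) : Prop :=
  (exists2 a : R, eigenvalue A a & mu = `|a|) /\
  forall a : R, eigenvalue A a -> mu <= `|a|.

Definition sigma (R : realType) (lmax mumin alpha : R) : R :=
  lmax / (alpha + lmax) * (Num.sqrt (alpha ^+ 2 + mumin ^+ 2) / mumin).

Definition minimizes_on_pos (R : realType) (f : R -> R) (a : R) : Prop :=
  0 < a /\ forall x : R, 0 < x -> f a <= f x.

(* Main.v *)
Require Import Defs.
From mathcomp Require Import all_boot all_order all_algebra.
From mathcomp Require Import reals.
From mathcomp Require Import ring.

Import Order.TTheory GRing.Theory Num.Theory.
Local Open Scope ring_scope.

(** By Cauchy-Schwarz, [m (a + l) <= sqrt (a^2 + m^2) * sqrt (m^2 + l^2)], which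
    rearranges to [l / sqrt (l^2 + m^2) <= sigma l m a]; equality holds when the
    vectors [(a, m)] and [(m, l)] are parallel, that is for [a = m^2 / l]. *)

(** Eigenvectors are rows here, so the quadratic form is evaluated at [v^T]. It equals [a] times
    [v *m v^T], a sum of squares; positivity of the product makes both factors positive. *)
Lemma spd_eigenvalue_gt0 (R : realType) (n : nat) (A : 'M[R]_n) (a : R) :
  spd A -> eigenvalue A a -> 0 < a.
Proof.
move=> [_ Apos] /eigenvalueP [v vA v0].
have := Apos v^T; rewrite trmx_eq0 => /(_ v0).
rewrite trmxK vA -scalemxAl mxE => av_gt0.
have vv_ge0 : 0 <= (v *m v^T) 0 0.
  by rewrite mxE sumr_ge0 // => i _; rewrite mxE -expr2 sqr_ge0.
have vv_gt0 : 0 < (v *m v^T) 0 0.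
  by rewrite lt_def vv_ge0 andbT; apply: contraTneq av_gt0 => ->; rewrite mulr0 ltxx.
by rewrite -(pmulr_lgt0 _ vv_gt0).
Qed.

Lemma unitmx_eigenvalue_neq0 (F : fieldType) (n : nat) (A : 'M[F]_n) (a : F) :
  A \in unitmx -> eigenvalue A a -> a != 0.
Proof.
move=> Au /eigenvalueP [v vA]; apply: contraNneq => a0.
by rewrite -(mulmxK Au v) vA a0 scale0r mul0mx.
Qed.

Lemma sigma_argmin (R : realType) (l m : R) : 0 < l -> 0 < m ->
  sigma l m (m ^+ 2 / l) = l / Num.sqrt (l ^+ 2 + m ^+ 2).
Proof.
move=> l0 m0; rewrite /sigma; set s := Num.sqrt (l ^+ 2 + m ^+ 2).
have q0 : 0 < l ^+ 2 + m ^+ 2 by rewrite addr_gt0 // exprn_gt0.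
have s0 : 0 < s by rewrite sqrtr_gt0.
have sE : s ^+ 2 = l ^+ 2 + m ^+ 2 by rewrite sqr_sqrtr // ltW.
have [ln mn sn] : [/\ l != 0, m != 0 & s != 0] by rewrite !gt_eqF.
(* At this point the radicand is a perfect square, so [sigma] becomes a rational expression in [l],
   [m] and [s]. *)
have -> : (m ^+ 2 / l) ^+ 2 + m ^+ 2 = (m * s / l) ^+ 2.
  by rewrite expr_div_n [in RHS]expr_div_n [in RHS]exprMn sE; field.
have -> : m ^+ 2 / l + l = s ^+ 2 / l by rewrite sE; field.
rewrite sqrtr_sqr ger0_norm; last by rewrite ltW // divr_gt0 // mulr_gt0.
by field; rewrite ln mn sn.
Qed.

Lemma sigma_ge (R : realType) (l m a : R) : 0 < l -> 0 < m -> 0 < a ->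
  l / Num.sqrt (l ^+ 2 + m ^+ 2) <= sigma l m a.
Proof.
move=> l0 m0 a0; rewrite /sigma.
have q0 : 0 < l ^+ 2 + m ^+ 2 by rewrite addr_gt0 // exprn_gt0.
have p0 : 0 <= a ^+ 2 + m ^+ 2 by rewrite addr_ge0 // sqr_ge0.
have al0 : 0 < a + l by rewrite addr_gt0.
(* Cancelling [l] and clearing the positive denominators leaves the Cauchy-Schwarz inequality with
   left side [(a + l) * m]. *)
rewrite -mulrA ler_pM2l // mulrA [_^-1 * _]mulrC -mulrA -invfM.
rewrite ler_pdivlMr ?mulr_gt0 // mulrC ler_pdivrMr ?sqrtr_gt0 // -sqrtrM //.
(* A positive left side is the root of its own square, so it suffices to compare radicands. *)
rewrite -[leLHS]ger0_norm; last by rewrite ltW // mulr_gt0.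
rewrite -sqrtr_sqr ler_wsqrtr // -subr_ge0.
(* Lagrange's identity: the gap is the squared determinant of [(a, m)] and [(m, l)]. *)
have -> : (a ^+ 2 + m ^+ 2) * (l ^+ 2 + m ^+ 2) - ((a + l) * m) ^+ 2
  = (a * l - m ^+ 2) ^+ 2 by ring.
exact: sqr_ge0.
Qed.

Theorem theorem2p2 (R : realType) (n : nat) (W T : 'M[R]_n)
    (lmax mumin : R)
    (W_spd : spd W)
    (T_sym : T \is symmetricmx)
    (T_indef : indefinite T)
    (T_nonsing : T \in unitmx)
    (lmaxP : largest_eigenvalue W lmax)
    (muminP : smallest_abs_eigenvalue T mumin) :
  0 < mumin /\
  minimizes_on_pos (sigma lmax mumin) (mumin ^+ 2 / lmax) /\
  sigma lmax mumin (mumin ^+ 2 / lmax) =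
    lmax / Num.sqrt (lmax ^+ 2 + mumin ^+ 2).
Proof.
(* Definiteness of [W] gives [0 < lmax] and nonsingularity of [T] gives [0 < mumin]; what remains
   concerns two positive scalars. *)
have l0 : 0 < lmax by case: lmaxP => lmaxW _; apply: spd_eigenvalue_gt0 lmaxW.
have m0 : 0 < mumin.
  case: muminP => -[a Ta ->] _.
  by rewrite normr_gt0; apply: unitmx_eigenvalue_neq0 Ta.
split=> //; split; last exact: sigma_argmin.
split; first by rewrite divr_gt0 // exprn_gt0.
by move=> x x0; rewrite sigma_argmin // sigma_ge.
Qed.
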